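(* Let $M$ be a nonzero commutative binoid. The semibinoids $\{0,\infty\}\text{-}\mathrm{spec}\,M$, $\mathrm{spec}\,M$ and $\mathcal F(M)\setminus\{M\}$ are isomorphic, namely via the mutually inverse maps $$\{0,\infty\}\text{-}\mathrm{spec}\,M\leftrightarrow\mathrm{spec}\,M,\qquad \alpha\mapsto\ker\alpha,\quad P\mapsto\alpha_P,$$ and $$\mathrm{spec}\,M\leftrightarrow\mathcal F(M)\setminus\{M\},\qquad P\mapsto M\setminus P,\quad F\mapsto M\setminus F,$$ where the latter correspondence is inclusion reversing.
   Context: A commutative binoid is a commutative monoid $(M,+,0)$ with an absorbing element $\infty$ ($a+\infty=\infty$); it is nonzero if $0\neq\infty$. Homomorphisms are monoid homomorphisms with $\infty\mapsto\infty$. A semibinoid is a semigroup with an absorbing element; homomorphisms preserve both. $M^\times$ denotes the unit group and $M_+=M\setminus M^\times$. $\{0,\infty\}$ is the two-element binoid (with $0\ne\infty$). $\{0,\infty\}\text{-}\mathrm{spec}\,M$ is the set of binoid homomorphisms $M\to\{0,\infty\}$ with pointwise addition; its absorbing element is the homomorphism that is $0$ on $M^\times$ and $\infty$ elsewhere. For $\alpha$ in it, $\ker\alpha=\alpha^{-1}(\infty)$. An ideal of $M$ is a subset $I$ with $\infty\in I$ and $I+M\subseteq I$; a prime ideal is an ideal $P\neq M$ such that $M\setminus P$ is a submonoid. $\mathrm{spec}\,M$ is the set of prime ideals, a semibinoid under union with absorbing element $M_+$. For $P$ prime, $\alpha_P:M\to\{0,\infty\}$ is $\infty$ on $P$ and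 $0$ on $M\setminus P$. A filter of $M$ is a subset $F\subseteq M$ with $0\in F$ such that for $f,g\in M$: $f+g\in F$ if and only if $f\in F$ and $g\in F$. $\mathcal F(M)$ is the set of all filters; $\mathcal F(M)\setminus\{M\}$ is a semibinoid under intersection with absorbing element $M^\times$. *)

(* Defs.v *)
From HB Require Import structures.
From mathcomp Require Import all_boot all_algebra.
From mathcomp Require Import boolp classical_sets.

Set Implicit Arguments.
Unset Strict Implicit.
Unset Printing Implicit Defensive.

Import GRing.Theory.

Local Open Scope classical_set_scope.
Local Open Scope ring_scope.

(* An [addSemigroupType] is a commutative semigroup and an [nmodType] a
   commutative monoid, so the structures below are the commutative ones. *)
HB.mixin Record hasAbsorbing V of Algebra.AddSemigroup V := {
  infty : V;
  addr_infty : right_zero infty (@Algebra.add V)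
}.

#[short(type="semibinoidType")]
HB.structure Definition Semibinoid :=
  {V of Algebra.AddSemigroup V & hasAbsorbing V}.

#[short(type="binoidType")]
HB.structure Definition Binoid := {V of GRing.Nmodule V & hasAbsorbing V}.

HB.mixin Record Binoid_isNonzero V of Binoid V := {
  zero_neq_infty : (0 : V) != infty
}.

#[short(type="nzBinoidType")]
HB.structure Definition NzBinoid := {V of Binoid V & Binoid_isNonzero V}.

Definition semibinoid_hom (S T : semibinoidType) (f : S -> T) : Prop :=
  {morph f : x y / x + y} /\ f infty = infty.

Definition binoid_hom (M N : binoidType) (f : M -> N) : Prop :=
  [/\ f 0 = 0, {morph f : x y / x + y} & f infty = infty].

Definition semibinoid_iso (S T : semibinoidType) (f : S -> T) (g : T -> S) :
    Prop :=
  [/\ semibinoid_hom f, semibinoid_hom g, cancel f g & cancel g f].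

(* The two-element binoid {0, infty}; [bool] itself cannot be used because it
   already carries the additive structure of F_2. *)
Inductive zero_infty : Type := ZI_zero | ZI_infty.

Definition zi_is_infty (x : zero_infty) : bool :=
  if x is ZI_infty then true else false.
Definition zi_of_bool (b : bool) : zero_infty :=
  if b then ZI_infty else ZI_zero.
Lemma zi_is_inftyK : cancel zi_is_infty zi_of_bool. Proof. by case. Qed.

HB.instance Definition _ := Choice.copy zero_infty (can_type zi_is_inftyK).

Definition zi_add (x y : zero_infty) : zero_infty :=
  if x is ZI_infty then ZI_infty else y.

Lemma zi_addA : associative zi_add. Proof. by case. Qed.
Lemma zi_addC : commutative zi_add. Proof. by case; case. Qed.
Lemma zi_add0 : left_id ZI_zero zi_add. Proof. by []. Qed.
HB.instance Definition _ :=
  GRing.isNmodule.Build zero_infty zi_addA zi_addC zi_add0.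

Lemma zi_addI : right_zero ZI_infty (@Algebra.add zero_infty).
Proof. by case. Qed.
HB.instance Definition _ := hasAbsorbing.Build zero_infty zi_addI.

Lemma zi_nonzero : (0 : zero_infty) != infty. Proof. by []. Qed.
HB.instance Definition _ := Binoid_isNonzero.Build zero_infty zi_nonzero.

Section Notions.
Variable M : binoidType.

Definition unit_group : set M := [set x | exists y, x + y = 0].

Definition nonunits : set M := ~` unit_group.

Definition submonoid (S : set M) : Prop :=
  S 0 /\ forall x y, S x -> S y -> S (x + y).

Definition is_ideal (I : set M) : Prop :=
  I infty /\ forall a x, I a -> I (a + x).

Definition is_prime_ideal (P : set M) : Prop :=
  [/\ is_ideal P, P <> setT & submonoid (~` P)].

Definition is_filter (F : set M) : Prop :=
  F 0 /\ forall f g, F (f + g) <-> F f /\ F g.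

Definition hom_ker (alpha : M -> zero_infty) : set M :=
  alpha @^-1` [set infty].

Definition prime_fun (P : set M) (x : M) : zero_infty :=
  if x \in P then infty else 0.

Record zi_spec : Type := ZiSpec {
  zi_spec_fun :> M -> zero_infty;
  zi_spec_hom : binoid_hom zi_spec_fun
}.

Record spec : Type := Spec {
  spec_set :> set M;
  spec_prime : is_prime_ideal spec_set
}.

Record proper_filter : Type := ProperFilter {
  proper_filter_set :> set M;
  proper_filter_filter : is_filter proper_filter_set;
  proper_filter_neqT : proper_filter_set <> setT
}.

Lemma zi_spec_inj : injective zi_spec_fun.
Proof.
by move=> [f fP] [g gP] /= fg; subst g; rewrite (Prop_irrelevance fP gP).
Qed.

Lemma spec_inj : injective spec_set.
Proof.
by move=> [f fP] [g gP] /= fg; subst g; rewrite (Prop_irrelevance fP gP).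
Qed.

Lemma proper_filter_inj : injective proper_filter_set.
Proof.
move=> [f fP fT] [g gP gT] /= fg; subst g.
by rewrite (Prop_irrelevance fP gP) (Prop_irrelevance fT gT).
Qed.

HB.instance Definition _ := gen_eqMixin zi_spec.
HB.instance Definition _ := gen_choiceMixin zi_spec.
HB.instance Definition _ := gen_eqMixin spec.
HB.instance Definition _ := gen_choiceMixin spec.
HB.instance Definition _ := gen_eqMixin proper_filter.
HB.instance Definition _ := gen_choiceMixin proper_filter.

Lemma zi_spec_add_hom (a b : zi_spec) :
  binoid_hom (fun x => a x + b x : zero_infty).
Proof.
case: a b => [a [a0 aD ai]] [b [b0 bD bi]] /=; split.
- by rewrite a0 b0 addr0.
- by move=> x y; rewrite aD bD addrACA.
- by rewrite ai bi.
Qed.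

Definition zi_spec_add (a b : zi_spec) : zi_spec := ZiSpec (zi_spec_add_hom a b).

Lemma zi_spec_addC : commutative zi_spec_add.
Proof. by move=> a b; apply/zi_spec_inj/funext => x /=; exact: addrC. Qed.
Lemma zi_spec_addA : associative zi_spec_add.
Proof. by move=> a b c; apply/zi_spec_inj/funext => x /=; exact: addrA. Qed.
HB.instance Definition _ :=
  Algebra.isAddSemigroup.Build zi_spec zi_spec_addC zi_spec_addA.

Lemma spec_union_prime (P Q : spec) : is_prime_ideal (P `|` Q).
Proof.
case: P Q => [P [[Pi PI] _ [P0 PD]]] [Q [[Qi QI] _ [Q0 QD]]] /=; split.
- split; first by left.
  by move=> a x [Pa|Qa]; [left; exact: PI|right; exact: QI].
- by move=> PQT; have [] : (P `|` Q) 0 by rewrite PQT.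
- split; first by case.
  move=> x y /not_orP[Px Qx] /not_orP[Py Qy].
  by case=> ?; [exact: (PD _ _ Px Py)|exact: (QD _ _ Qx Qy)].
Qed.

Definition spec_union (P Q : spec) : spec := Spec (spec_union_prime P Q).

Lemma spec_unionC : commutative spec_union.
Proof. by move=> P Q; apply/spec_inj/setUC. Qed.
Lemma spec_unionA : associative spec_union.
Proof. by move=> P Q R; apply/spec_inj/setUA. Qed.
HB.instance Definition _ :=
  Algebra.isAddSemigroup.Build spec spec_unionC spec_unionA.

Lemma proper_filter_inter_filter (F G : proper_filter) : is_filter (F `&` G).
Proof.
case: F G => [F [F0 FD] _] [G [G0 GD] _] /=; split=> // f g.
split=> [[/FD[? ?] /GD[? ?]]//|[[? ?] [? ?]]].
by split; [apply/FD|apply/GD].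
Qed.

Lemma proper_filter_inter_neqT (F G : proper_filter) : F `&` G <> setT.
Proof.
move=> FGT; apply: (@proper_filter_neqT F); apply/seteqP; split=> // x _.
by have [] : (F `&` G) x by rewrite FGT.
Qed.

Definition proper_filter_inter (F G : proper_filter) : proper_filter :=
  ProperFilter (proper_filter_inter_filter F G) (@proper_filter_inter_neqT F G).

Lemma proper_filter_interC : commutative proper_filter_inter.
Proof. by move=> F G; apply/proper_filter_inj/setIC. Qed.
Lemma proper_filter_interA : associative proper_filter_inter.
Proof. by move=> F G H; apply/proper_filter_inj/setIA. Qed.
HB.instance Definition _ := Algebra.isAddSemigroup.Build proper_filter
  proper_filter_interC proper_filter_interA.

End Notions.

(* The absorbing elements exist only when M is nonzero: over the zero binoid
   all three types are empty. *)
Section Absorbing.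
Variable M : nzBinoidType.

Lemma unit_group0 : unit_group (0 : M). Proof. by exists 0; rewrite addr0. Qed.

Lemma unit_groupD (x y : M) :
  unit_group (x + y) <-> unit_group x /\ unit_group y.
Proof.
split=> [[z xyz]|[[u xu] [v yv]]].
  by split; [exists (y + z)|exists (x + z)]; rewrite ?addrA // [y + x]addrC.
by exists (u + v); rewrite addrACA xu yv addr0.
Qed.

Lemma unit_groupNinfty : ~ unit_group (infty : M).
Proof.
case=> y; rewrite addrC addr_infty => /esym/eqP.
by rewrite (negbTE zero_neq_infty).
Qed.

Definition zi_spec_infty_fun (x : M) : zero_infty :=
  if x \in @unit_group M then 0 else infty.

Lemma zi_spec_infty_hom : binoid_hom zi_spec_infty_fun.
Proof.
rewrite /zi_spec_infty_fun; split.
- by rewrite mem_set //; exact: unit_group0.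
- move=> x y.
  have -> : (x + y \in @unit_group M) =
            (x \in @unit_group M) && (y \in @unit_group M).
    apply/idP/andP => [/set_mem/unit_groupD[? ?]|[/set_mem ? /set_mem ?]].
      by split; exact: mem_set.
    by apply/mem_set/unit_groupD.
  by case: (x \in _); case: (y \in _).
- by rewrite memNset //; exact: unit_groupNinfty.
Qed.

Definition zi_spec_infty : zi_spec M := ZiSpec zi_spec_infty_hom.

Lemma zi_spec_addI : right_zero zi_spec_infty (@Algebra.add (zi_spec M)).
Proof.
move=> a; apply/zi_spec_inj/funext => x /=; rewrite /zi_spec_infty_fun.
case: ifPn => [/set_mem[y xy]|_]; last exact: addr_infty.
case: a => a [a0 aD _] /=; rewrite addr0.
by have := aD x y; rewrite xy a0; case: (a x).
Qed.
HB.instance Definition _ := hasAbsorbing.Build (zi_spec M) zi_spec_addI.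

Lemma nonunits_prime : is_prime_ideal (@nonunits M).
Proof.
split.
- split; first exact: unit_groupNinfty.
  by move=> a x aN /unit_groupD[].
- move=> NT; have : nonunits (0 : M) by rewrite NT.
  by apply; exact: unit_group0.
- rewrite /nonunits setCK; split; first exact: unit_group0.
  by move=> x y ? ?; apply/unit_groupD.
Qed.

Definition spec_infty : spec M := Spec nonunits_prime.

Lemma spec_unionI : right_zero spec_infty (@Algebra.add (spec M)).
Proof.
move=> [P PP]; apply/spec_inj/setUidPr => x /= Px [y xy].
case: PP => -[_ PI] _ [P0 _]; apply: P0; rewrite -xy; exact: PI.
Qed.
HB.instance Definition _ := hasAbsorbing.Build (spec M) spec_unionI.

Lemma unit_group_filter : is_filter (@unit_group M).
Proof. by split; [exact: unit_group0|exact: unit_groupD]. Qed.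

Lemma unit_group_neqT : @unit_group M <> setT.
Proof. by move=> UT; apply: unit_groupNinfty; rewrite UT. Qed.

Definition proper_filter_infty : proper_filter M :=
  ProperFilter unit_group_filter unit_group_neqT.

Lemma proper_filter_interI :
  right_zero proper_filter_infty (@Algebra.add (proper_filter M)).
Proof.
move=> [F [F0 FD] FT]; apply/proper_filter_inj/setIidPr => x /= [y xy].
by have /FD[] : F (x + y) by rewrite xy.
Qed.
HB.instance Definition _ :=
  hasAbsorbing.Build (proper_filter M) proper_filter_interI.

End Absorbing.

(* Main.v *)
Require Import Defs.
From mathcomp Require Import all_boot all_algebra.
From mathcomp Require Import boolp classical_sets.

Local Open Scope classical_set_scope.
Local Open Scope ring_scope.

Import GRing.Theory.

(** A map into the two-element binoid is determined by where it takes the value [infty], and there a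
    sum is [infty] exactly when a summand is. So being a homomorphism is a condition on the kernel
    P: it contains [infty], omits 0, and contains x + y iff it contains x or y. By [prime_idealD]
    this is what a prime ideal satisfies. Negating the condition turns [or] into [and] and yields
    the filter axioms for the complement, with [infty] in P corresponding to properness of the
    filter. The same dictionary carries pointwise sums to unions and unions to intersections, and
    matches the absorbing elements, all of which are determined by the unit group. *)

(** The inverse of a bijective homomorphism is again one, so only one direction of each
    correspondence has to be checked for compatibility. *)
Lemma semibinoid_isoP (S T : semibinoidType) (f : S -> T) (g : T -> S) :
  semibinoid_hom f -> cancel f g -> cancel g f -> semibinoid_iso f g.
Proof.
move=> [fD fi] fK gK; split=> //; split; last by rewrite -fi fK.
by move=> x y; rewrite -{1}[x]gK -{1}[y]gK -fD fK.
Qed.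

Lemma zi_add_eq_infty (x y : zero_infty) :
  x + y = infty <-> x = infty \/ y = infty.
Proof.
by case: x; case: y; split=> //; [case|right|left|left].
Qed.

Section Correspondence.
Variable M : binoidType.

(** Left to right is the contrapositive of closure of the complement under addition; right to left
    is the ideal property. *)
Lemma prime_idealD (P : set M) (x y : M) :
  is_prime_ideal P -> P (x + y) <-> P x \/ P y.
Proof.
case=> [[_ PI] _ [_ PD]]; split=> [Pxy|[Px|Py]].
- by apply: contrapT => /not_orP[Px Py]; exact: (PD x y).
- exact: PI.
- by rewrite addrC; exact: PI.
Qed.

Lemma prime_idealN0 (P : set M) : is_prime_ideal P -> ~ P 0.
Proof. by case=> _ _ []. Qed.

(** Every x is a summand of [infty] = x + [infty], so a filter containing [infty] is everything. *)
Lemma filterNinfty (F : set M) : is_filter F -> F <> setT -> ~ F infty.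
Proof.
move=> [_ FD] FT Fi; apply: FT; apply/seteqP; split=> // x _.
by have /FD[] : F (x + infty) by rewrite addr_infty.
Qed.

Lemma hom_ker_prime (a : M -> zero_infty) :
  binoid_hom a -> is_prime_ideal (hom_ker a).
Proof.
rewrite /hom_ker => -[a0 aD ai].
have kerN0 : ~ (a @^-1` [set infty]) 0 by rewrite /= a0.
split.
- by split=> //= x y ax; rewrite aD; apply/zi_add_eq_infty; left.
- by move=> kerT; apply: kerN0; rewrite kerT.
- by split=> //= x y ax ay; rewrite aD => /zi_add_eq_infty[].
Qed.

Lemma prime_fun_infty (P : set M) (x : M) : prime_fun P x = infty <-> P x.
Proof.
rewrite /prime_fun; case: ifPn => [/set_mem//|/negP xP].
by split=> // Px; case: xP; exact: mem_set.
Qed.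

(** Reduces equations between values in the two-element binoid to equivalences of membership in
    kernels. *)
Lemma zi_eq_infty (x y : zero_infty) : (x = infty <-> y = infty) -> x = y.
Proof.
by case: x; case: y => // -[xy yx]; [have := yx erefl|have := xy erefl].
Qed.

Lemma prime_fun_hom (P : set M) : is_prime_ideal P -> binoid_hom (prime_fun P).
Proof.
move=> PP; split.
- by rewrite /prime_fun memNset //; exact: prime_idealN0.
- move=> x y; apply: zi_eq_infty; rewrite zi_add_eq_infty !prime_fun_infty.
  exact: prime_idealD.
- by apply/prime_fun_infty; case: PP => -[].
Qed.

Lemma hom_kerK (a : M -> zero_infty) : prime_fun (hom_ker a) = a.
Proof. by apply/funext => x; apply: zi_eq_infty; rewrite prime_fun_infty. Qed.

Lemma prime_funK (P : set M) : hom_ker (prime_fun P) = P.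
Proof. by apply/seteqP; split=> x /prime_fun_infty. Qed.

Lemma setC_prime_filter (P : set M) : is_prime_ideal P -> is_filter (~` P).
Proof.
move=> PP; split; first exact: prime_idealN0.
by move=> x y; rewrite /setC /= (prime_idealD _ _ _ PP) not_orP.
Qed.

Lemma setC_prime_neqT (P : set M) : is_prime_ideal P -> ~` P <> setT.
Proof.
by case=> -[Pi _] _ _ PT; have : (~` P) infty by rewrite PT.
Qed.

(** The two directions of the filter equivalence give, respectively, the ideal property of the
    complement and closure of F under addition. *)
Lemma setC_filter_prime (F : set M) :
  is_filter F -> F <> setT -> is_prime_ideal (~` F).
Proof.
move=> FF FT; have Fi := filterNinfty _ FF FT; case: FF => F0 FD; split.
- by split=> // x y Fx /FD[].
- by move=> CT; have : (~` F) 0 by rewrite CT.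
- by rewrite setCK; split=> // x y Fx Fy; apply/FD.
Qed.

Definition ker_spec (a : zi_spec M) : spec M :=
  Spec (hom_ker_prime a (zi_spec_hom a)).

Definition fun_zi_spec (P : spec M) : zi_spec M :=
  ZiSpec (prime_fun_hom P (spec_prime P)).

Definition spec_filter (P : spec M) : proper_filter M :=
  ProperFilter (setC_prime_filter P (spec_prime P))
               (setC_prime_neqT P (spec_prime P)).

Definition filter_spec (F : proper_filter M) : spec M :=
  Spec (setC_filter_prime F (proper_filter_filter F)
                          (@proper_filter_neqT M F)).

End Correspondence.

Lemma ker_spec_iso (M : nzBinoidType) :
  semibinoid_iso (@ker_spec M) (@fun_zi_spec M).
Proof.
apply: semibinoid_isoP.
- split=> [a b|]; apply/spec_inj/seteqP; split=> x /=.
  + by move/zi_add_eq_infty.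
  + by move=> ?; apply/zi_add_eq_infty.
  (* Absorbing elements: the absorbing homomorphism is [infty] exactly off the unit group, so its
     kernel is [nonunits]. *)
  + rewrite /hom_ker /= /zi_spec_infty_fun.
    by case: ifPn => // /negP xU _ /mem_set.
  + by move=> xU; rewrite /hom_ker /= /zi_spec_infty_fun memNset.
- by move=> a; apply/zi_spec_inj/hom_kerK.
- by move=> P; apply/spec_inj/prime_funK.
Qed.

Lemma spec_filter_iso (M : nzBinoidType) :
  semibinoid_iso (@spec_filter M) (@filter_spec M).
Proof.
apply: semibinoid_isoP.
(* De Morgan handles the operation; for the absorbing elements, the complement of [nonunits] is a
   double complement of the unit group. *)
- split=> [P Q|]; apply/proper_filter_inj; [exact: setCU|exact: setCK].
- by move=> P; apply/spec_inj/setCK.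
- by move=> F; apply/proper_filter_inj/setCK.
Qed.

Theorem corollary2p2p6 (M : nzBinoidType) :
  (exists (kappa : zi_spec M -> spec M) (alpha : spec M -> zi_spec M),
    [/\ forall a : zi_spec M, kappa a = hom_ker a :> set M,
        forall P : spec M, alpha P = prime_fun P :> (M -> zero_infty)
      & semibinoid_iso kappa alpha]) /\
  (exists (phi : spec M -> proper_filter M) (psi : proper_filter M -> spec M),
    [/\ forall P : spec M, phi P = ~` P :> set M,
        forall F : proper_filter M, psi F = ~` F :> set M,
        semibinoid_iso phi psi,
        forall P Q : spec M, P `<=` Q -> phi Q `<=` phi P
      & forall F G : proper_filter M, F `<=` G -> psi G `<=` psi F]).
Proof.
split.
  exists (@ker_spec M), (@fun_zi_spec M).
  by split=> //; exact: ker_spec_iso.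
exists (@spec_filter M), (@filter_spec M).
split=> //; first exact: spec_filter_iso.
- by move=> P Q; exact: subsetC.
- by move=> F G; exact: subsetC.
Qed.
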